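(* Let $n\ge 2$, $p$, $k$, $l$ be integers with $1\le p<n$, $2\le k\le N=\binom{n}{p}$ and $0\le l<k$. There is a positive constant $C_1$ depending only on $n,k,l,p$ such that for every $\lambda=(\lambda_1,\dots,\lambda_n)\in\mathcal{P}_{p,k}$ with $\lambda_1<0$, $$\frac{\partial}{\partial\lambda_1}\left[\frac{\sigma_k(\Lambda(\lambda))}{\sigma_l(\Lambda(\lambda))}\right]\ \ge\ C_1\sum_{i=1}^n\frac{\partial}{\partial\lambda_i}\left[\frac{\sigma_k(\Lambda(\lambda))}{\sigma_l(\Lambda(\lambda))}\right].$$
   Context: Let $\mathfrak{J}(p,n)$ be the set of multi-indices $I=(i_1,\dots,i_p)$ with $1\le i_1<\cdots<i_p\le n$, enumerated in a fixed order as $I_1,\dots,I_N$, $N=\binom{n}{p}$. For $\lambda=(\lambda_1,\dots,\lambda_n)\in\mathbb{R}^n$ put $\Lambda_I=\lambda_{i_1}+\cdots+\lambda_{i_p}$ and $\Lambda(\lambda)=(\Lambda_{I_1},\dots,\Lambda_{I_N})\in\mathbb{R}^N$. $\sigma_m$ is the $m$-th elementary symmetric function on $\mathbb{R}^N$, with $\sigma_0=1$. The cone $\mathcal{P}_{p,k}$ is $\{\lambda\in\mathbb{R}^n:\sigma_j(\Lambda(\lambda))>0\text{ for all }1\le j\le k\}$. No ordering of the $\lambda_i$ is assumed. *)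

(* Defs.v *)
From HB Require Import structures.
From mathcomp Require Import all_boot all_order all_algebra.
From mathcomp Require Import all_classical all_reals all_analysis.
From mathcomp Require mpoly.
Import Order.TTheory GRing.Theory Num.Theory.
Import numFieldNormedType.Exports.

Set Implicit Arguments.
Unset Strict Implicit.
Unset Printing Implicit Defensive.

Local Open Scope ring_scope.

(* Indices are 0-based: 'I_n stands for {1, ..., n}. *)
Definition multi_indices (p n : nat) : {set p.-tuple 'I_n} :=
  [set I : p.-tuple 'I_n | sorted ltn (map val I)]%SET.

Lemma card_multi_indices (p n : nat) : #|multi_indices p n| = 'C(n, p).
Proof. exact: card_ltn_sorted_tuples. Qed.

Definition multi_index (p n : nat) (j : 'I_('C(n, p))) : p.-tuple 'I_n :=
  enum_val (cast_ord (esym (card_multi_indices p n)) j).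

Definition Lambda (R : realType) (p n : nat) (lambda : 'rV[R]_n) :
    'rV[R]_('C(n, p)) :=
  \row_(j < 'C(n, p)) \sum_(q < p) lambda 0 (tnth (multi_index j) q).

Definition sigma (R : realType) (N m : nat) (x : 'rV[R]_N) : R :=
  mpoly.meval (fun j : 'I_N => x 0 j) (mpoly.mesym N R m).

Lemma sigmaE (R : realType) (N m : nat) (x : 'rV[R]_N) :
  sigma m x = \sum_(h : {set 'I_N} | #|h| == m) \prod_(i in h) x 0 i.
Proof.
rewrite /sigma /mpoly.mesym (big_morph _ (mpoly.mevalD _) (mpoly.meval0 _)).
apply: eq_bigr => h _.
rewrite (big_morph _ (mpoly.mevalM _) (mpoly.meval1 _)).
by apply: eq_bigr => i _; rewrite mpoly.mevalXU.
Qed.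

Definition Pcone (R : realType) (n p k : nat) : set 'rV[R]_n :=
  [set lambda | forall j : nat, (1 <= j <= k)%N ->
     0 < sigma j (Lambda p lambda)]%classic.

Definition hessian_quotient (R : realType) (n p k l : nat)
    (lambda : 'rV[R]_n) : R :=
  sigma k (Lambda p lambda) / sigma l (Lambda p lambda).

(* 'D_v is a limit of difference quotients, hence total; it is the actual
   derivative wherever f is derivable along the i-th coordinate vector. *)
Definition partial (R : realType) (n : nat) (i : 'I_n)
    (f : 'rV[R]_n -> R) (lambda : 'rV[R]_n) : R :=
  'D_(delta_mx 0 i) (f : 'rV[R]_n -> R^o) lambda.

(* Main.v *)
Require Import Defs.
From HB Require Import structures.
From mathcomp Require Import all_boot all_order all_algebra.
From mathcomp Require Import ring lra.
From mathcomp Require Import all_classical all_reals all_analysis.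
Import Order.TTheory GRing.Theory Num.Theory.
Import numFieldNormedType.Exports.
Local Open Scope ring_scope.

Set Implicit Arguments.
Unset Strict Implicit.
Unset Printing Implicit Defensive.

(* Write f = sigma_k / sigma_l on R^N, so that d_i(f o Lambda) is the sum of
   f_I := (df/dx_I)(Lambda) over I containing i. With x = Lambda and s_m, d_m the
   elementary symmetric functions of x and of x without its entry x_I,
     s_l^2 f_I = d_{k-1} s_l - s_k d_{l-1} = d_{k-1} d_l - d_k d_{l-1},
   which Newton's inequality bounds below by d_{k-1} d_l / k. If x_I < 0, or if
   x_I is the smallest entry, then N d_m >= s_m for m < k, whence f_I dominates
   the sum of all f_J, as s_l^2 sum_J f_J <= N s_{k-1} s_l. Such an I containing
   the index 1 exists because lambda_1 < 0. *)

(** Letting [A] vary inside a fixed index type turns the deletion of an entry into [A :\ i], so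
    inductions can run on [#|A|]. *)
Definition esub (R : pzRingType) (T : finType) (x : T -> R) (A : {set T})
    (m : nat) : R :=
  \sum_(h : {set T} | (h \subset A) && (#|h| == m)) \prod_(i in h) x i.

(** * Identities for elementary symmetric functions, and Newton's inequality *)

Section ElementarySymmetric.
Import mathcomp.boot.finset.
Variables (R : realFieldType) (T : finType) (x : T -> R).
Implicit Types (A : {set T}) (i j : T) (m k l : nat).
Local Notation e := (esub x).

Lemma esub0 A : e A 0 = 1.
Proof.
rewrite /esub (big_pred1 set0) ?big_set0// => h /=.
by rewrite cards_eq0 andbC; case: eqP => //= ->; rewrite sub0set.
Qed.

Lemma esub_set0 m : e set0 m.+1 = 0.
Proof.
rewrite /esub big_pred0// => h; rewrite subset0.
by case: eqP => //= ->; rewrite cards0.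
Qed.

Lemma esub_split A i m : i \in A ->
  e A m.+1 = e (A :\ i) m.+1 + x i * e (A :\ i) m.
Proof.
move=> iA; rewrite /esub (bigID (fun h : {set T} => i \in h)) /= addrC; congr (_ + _).
  apply: eq_bigl => h; rewrite subsetD1.
  by case: (h \subset A); case: (i \in h); case: (_ == _).
rewrite (reindex_onto (fun h : {set T} => i |: h) (fun h => h :\ i)) /=; last first.
  by move=> h /andP[_ ih]; rewrite setD1K.
rewrite mulr_sumr; apply: eq_big => [h|h].
  rewrite setU11 andbT subUset sub1set iA /= subsetD1 cardsU1.
  have [ih|ih] := boolP (i \in h).
    rewrite !andbF /=; apply/negbTE/negP => /andP[_ /eqP E].
    by move: ih; rewrite -E setD11.
  by rewrite setU1K// eqxx !andbT add1n eqSS.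
by case/andP=> _ /eqP E; rewrite big_setU1//= -E setD11.
Qed.

(** Euler's identity: each product of m+1 entries arises once from each of its factors. *)
Lemma sum_x_esub_del A m : \sum_(i in A) x i * e (A :\ i) m = m.+1%:R * e A m.+1.
Proof.
have [n le_n] := ubnP #|A|; elim: n A m le_n => // n IH A m le_n.
have [->|[i0 iA]] := set_0Vmem A; first by rewrite big_set0 esub_set0 mulr0.
have cA : (#|A :\ i0| < n)%N by rewrite (cardsD1 i0) iA in le_n.
rewrite (bigD1 i0)//= (esub_split _ iA).
have -> : \sum_(i in A | i != i0) x i * e (A :\ i) m =
  \sum_(i in A :\ i0) x i * e (A :\ i) m.
  by apply: eq_bigl => i; rewrite !inE andbC.
case: m => [|m].
  rewrite (eq_bigr (fun i => x i * e (A :\ i0 :\ i) 0)) => [|i _]; last by rewrite !esub0.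
  by rewrite IH//; ring.
rewrite (eq_bigr (fun i => x i * e (A :\ i0 :\ i) m.+1 +
   x i0 * (x i * e (A :\ i0 :\ i) m))) => [|i]; last first.
  rewrite !inE => /andP[ii0 _].
  have i0A : i0 \in A :\ i by rewrite !inE eq_sym ii0.
  rewrite (esub_split _ i0A) !setDDl [[set i0] :|: _]finset.setUC; ring.
by rewrite big_split -mulr_sumr/= !IH// -[in RHS]natr1 -[m.+1%:R]natr1; ring.
Qed.

(** An m-subset of [A] survives the deletion of any of the [#|A|] - m indices outside it; for m >
    [#|A|] both sides vanish. *)
Lemma sum_esub_del A m : \sum_(i in A) e (A :\ i) m = (#|A|%:R - m%:R) * e A m.
Proof.
case: m => [|m].
  under eq_bigr do rewrite esub0.
  by rewrite esub0 sumr_const subr0 mulr1.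
have -> : \sum_(i in A) e (A :\ i) m.+1 = \sum_(i in A) (e A m.+1 - x i * e (A :\ i) m).
  by apply: eq_bigr => i iA; rewrite (esub_split _ iA) addrK.
by rewrite sumrB sumr_const sum_x_esub_del mulrBl !mulr_natl.
Qed.

(* With L_m(A) = e_m(A)^2 - e_{m-1}(A) e_{m+1}(A), one has the sum of squares
     (m + 1) L_m(A) = e_m(A)^2 + \sum_(i in A) x_i^2 L_{m-1}(A - i),
   which gives L_m >= 0 by induction, for real x of any signs. The factor
   m / (m + 1) is the limit of Newton's optimal constants as #|A| grows. *)
Lemma esub_newton A m :
  m.+2%:R * (e A m * e A m.+2) <= m.+1%:R * e A m.+1 ^+ 2.
Proof.
suff : e A m.+1 ^+ 2 <= m.+2%:R * (e A m.+1 ^+ 2 - e A m * e A m.+2).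
  by rewrite -[m.+2%:R]natr1; lra.
elim: m A => [|m IH] A.
  have -> : 2%:R * (e A 1 ^+ 2 - e A 0 * e A 2) =
     e A 1 ^+ 2 + \sum_(i in A) x i ^+ 2.
    have E0 : \sum_(i in A) x i = e A 1.
      have := sum_x_esub_del A 0; rewrite mul1r => <-.
      by apply: eq_bigr => i _; rewrite esub0 mulr1.
    have -> : \sum_(i in A) x i ^+ 2 = \sum_(i in A) (x i * e A 1 - x i * e (A :\ i) 1).
      by apply: eq_bigr => i iA; rewrite (esub_split _ iA) esub0; ring.
    by rewrite sumrB -mulr_suml E0 sum_x_esub_del esub0; ring.
  by rewrite lerDl sumr_ge0// => i _; rewrite sqr_ge0.
have -> : m.+3%:R * (e A m.+2 ^+ 2 - e A m.+1 * e A m.+3) = e A m.+2 ^+ 2 +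
    \sum_(i in A) x i ^+ 2 * (e (A :\ i) m.+1 ^+ 2 - e (A :\ i) m * e (A :\ i) m.+2).
  rewrite (eq_bigr (fun i => e A m.+2 * (x i * e (A :\ i) m.+1) -
      e A m.+1 * (x i * e (A :\ i) m.+2))) => [|i iA].
    by rewrite sumrB -!mulr_sumr !sum_x_esub_del -[m.+3%:R]natr1; ring.
  by rewrite (esub_split m.+1 iA) (esub_split m iA); ring.
rewrite lerDl sumr_ge0// => i _; rewrite mulr_ge0 ?sqr_ge0//.
by have := le_trans (sqr_ge0 _) (IH (A :\ i)); rewrite pmulr_rge0.
Qed.

Lemma esub_ge0 A m : (forall i, 0 <= x i) -> 0 <= e A m.
Proof. by move=> x0; apply: sumr_ge0 => h _; apply: prodr_ge0. Qed.

(* If b = e_{m+1}(A - i) <= 0 came after a = e_m(A - i) > 0, positivity of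
   e_{m+1}(A) and e_{m+2}(A) would give e_{m+2}(A - i) a > b^2. *)
Lemma esub_del_gt0 A i k m : (forall j : nat, (1 <= j <= k.+1)%N -> 0 < e A j) ->
  i \in A -> (m <= k)%N -> 0 < e (A :\ i) m.
Proof.
move=> pos iA; elim: m => [|m IH] mk; first by rewrite esub0.
have {}IH := IH (ltnW mk).
have := esub_newton (A :\ i) m.
have : 0 < e A m.+1 by apply: pos; exact: leqW.
have : 0 < e A m.+2 by exact: pos.
rewrite !(esub_split _ iA) -[m.+2%:R]natr1.
move: (e _ m) (e _ m.+1) (e _ m.+2) IH => a b c a0 bc ab N.
rewrite ltNge; apply/negP => b0.
have : 0 < m.+1%:R :> R by exact: ltr0Sn.
move: (m.+1%:R) N => M N M0.
have : 0 < (c + x i * b) * a by rewrite mulr_gt0.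
have : 0 <= (b + x i * a) * (- b) by apply: mulr_ge0; lra.
have := sqr_ge0 b.
move=> ? ? ?.
have H : b ^+ 2 < a * c by nra.
(* [N] says that (M+1) a c <= M b^2, so this bound forces a c <= 0, against [H]. *)
have : M * b ^+ 2 <= M * (a * c) by rewrite ler_wpM2l// ltW.
nra.
Qed.

(** By Newton, the ratio e_{m+1}/e_m shrinks at least by the factor (m+1)/(m+2) when m grows by one.
    Of the factors accumulated from l to k only the last, k/(k+1), is kept. *)
Lemma esub_newton_chain A k l : (forall m, (m <= k)%N -> 0 < e A m) -> (l < k)%N ->
  k.+1%:R * (e A k.+1 * e A l) <= k%:R * (e A k * e A l.+1).
Proof.
elim: k => // k IH pos; rewrite ltnS leq_eqVlt => /predU1P[->|lk].
  by rewrite mulrC (mulrC (e _ _)) mulrC -expr2; exact: esub_newton.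
have {}IH := IH (fun m mk => pos m (leqW mk)) lk.
have N := esub_newton A k.
have p0 : 0 < e A k by exact: pos.
have p1 : 0 < e A k.+1 by exact: pos.
have pl : 0 < e A l by apply: pos; rewrite leqW// ltnW.
have pl1 : 0 < e A l.+1 by apply: pos; rewrite ltnW.
rewrite -(ler_pM2r p0).
have : k.+2%:R * (e A k * e A k.+2) * e A l <= k.+1%:R * e A k.+1 ^+ 2 * e A l.
  by rewrite ler_pM2r.
have : e A k.+1 * (k.+1%:R * (e A k.+1 * e A l)) <=
    e A k.+1 * (k%:R * (e A k * e A l.+1)) by rewrite ler_pM2l.
(* This term pays for replacing the factor k of the induction hypothesis by k+1. *)
have : 0 <= e A k.+1 * e A k * e A l.+1 by rewrite !mulr_ge0// ltW.
rewrite -[k.+1%:R]natr1.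
lra.
Qed.


(* The partial derivative of e_m(A) in x_i; the value 0 at m = 0 is e_{-1}. *)
Definition desub A i m := if m is m'.+1 then e (A :\ i) m' else 0.

Lemma esub_desub A i m : i \in A -> e A m = e (A :\ i) m + x i * desub A i m.
Proof.
case: m => [|m] iA; first by rewrite !esub0 mulr0 addr0.
exact: esub_split.
Qed.

Lemma sum_desub_ge0 A k l : (forall m, (m <= k.+1)%N -> 0 < e A m) ->
  (l <= k)%N -> 0 <= \sum_(i in A) desub A i l.
Proof.
move=> pos lk; apply: sumr_ge0 => i iA; case: l lk => //= l lk.
apply: ltW; apply: (@esub_del_gt0 A i k) => //; last exact: ltnW.
by move=> j /andP[_]; exact: pos.
Qed.

(* The numerator of the derivative of e_k / e_l in x_i. *)
Definition quotient_num A k l i := desub A i k * e A l - e A k * desub A i l.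

(** * Bounds on the derivative of e_{k+1}/e_l where e_0, ..., e_{k+1} are positive *)

Section Cone.
Variables (A : {set T}) (k l : nat).
Hypotheses (pos : forall m : nat, (m <= k.+1)%N -> 0 < e A m) (lk : (l <= k)%N).

Let del_gt0 i m : i \in A -> (m <= k)%N -> 0 < e (A :\ i) m.
Proof. by move=> iA; apply: esub_del_gt0 => // j /andP[_]; exact: pos. Qed.

(** With d_m = [e (A :\ i) m], the terms in [x i] cancel and leave d_k d_l - d_{k+1} d_{l-1}; the
    chain at l-1 bounds the second product by k/(k+1) times the first. *)
Lemma quotient_num_ge i : i \in A ->
  e (A :\ i) k * e (A :\ i) l <= k.+1%:R * quotient_num A k.+1 l i.
Proof.
move=> iA; rewrite /quotient_num !(esub_desub _ iA)/=.
have p0 : 0 < e (A :\ i) k by exact: del_gt0.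
have pl : 0 < e (A :\ i) l by exact: del_gt0.
case: l lk pl => [|l' l'k] /= pl.
  (* For l = 0 the numerator is d_k alone. *)
  by rewrite esub0 !mulr0 addr0 subr0 mulr1 ler_peMl ?ler1n// ltW.
have := @esub_newton_chain (A :\ i) k l' (fun m => @del_gt0 i m iA) l'k.
by rewrite -[k.+1%:R]natr1; lra.
Qed.

Lemma quotient_num_ge0 i : i \in A -> 0 <= quotient_num A k.+1 l i.
Proof.
move=> iA; rewrite -(pmulr_rge0 _ (ltr0Sn R k)).
by apply: le_trans (quotient_num_ge iA); rewrite mulr_ge0// ltW// del_gt0.
Qed.

Lemma sum_quotient_num_le :
  \sum_(i in A) quotient_num A k.+1 l i <= #|A|%:R * (e A k * e A l).
Proof.
rewrite sumrB -mulr_suml -mulr_sumr /= sum_esub_del.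
have sl : 0 <= e A k.+1 * \sum_(i in A) desub A i l.
  by rewrite mulr_ge0 ?(sum_desub_ge0 _ lk)// ltW// pos.
have : 0 <= k%:R * (e A k * e A l).
  by rewrite !mulr_ge0// ltW// pos// ltnW.
lra.
Qed.

(** Deleting a negative entry does not decrease e_m; the factor [#|A|] is there to match the bound
    for a smallest entry. *)
Lemma le_esub_del_neg i m : i \in A -> x i < 0 -> (m <= k)%N ->
  e A m <= #|A|%:R * e (A :\ i) m.
Proof.
move=> iA xi mk; apply: (@le_trans _ _ (e (A :\ i) m)).
  case: m mk => [|m] mk; first by rewrite !esub0.
  rewrite (esub_split m iA) gerDl nmulr_rle0// ltW// del_gt0//; exact: ltnW.
apply: ler_peMl; first exact/ltW/del_gt0.
by rewrite ler1n card_gt0; apply/set0Pn; exists i.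
Qed.

(** Deleting the smallest entry gives the largest of the [e (A :\ j) m], and these sum to ([#|A|] -
    m) e_m >= e_m. *)
Lemma le_esub_del_min i m : i \in A -> (forall j, 0 <= x j) ->
  (forall j, x i <= x j) -> (m < #|A|)%N -> e A m <= #|A|%:R * e (A :\ i) m.
Proof.
move=> iA x0 xmin mA.
have le_del j : j \in A -> e (A :\ j) m <= e (A :\ i) m.
  move=> jA; have [->//|ij] := eqVneq i j.
  case: m {mA} => [|m]; first by rewrite !esub0.
  have jAi : j \in A :\ i by rewrite !inE eq_sym ij.
  have iAj : i \in A :\ j by rewrite !inE ij.
  rewrite (esub_split _ jAi) (esub_split _ iAj).
  by rewrite !setDDl [[set j] :|: _]setUC lerD2l ler_wpM2r ?esub_ge0.
apply: (@le_trans _ _ ((#|A|%:R - m%:R) * e A m)).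
  by rewrite ler_peMl ?esub_ge0// -natrB ?ler1n ?subn_gt0// ltnW.
by rewrite -sum_esub_del mulr_natl -sumr_const; exact: ler_sum.
Qed.

(** In the constant, k+1 comes from [quotient_num_ge], one [#|A|] from [sum_quotient_num_le], and
    the other two from deleting entry i in e_k and in e_l. *)
Lemma quotient_num_lower i : i \in A -> (k < #|A|)%N ->
  x i < 0 \/ (forall j, x i <= x j) ->
  \sum_(j in A) quotient_num A k.+1 l j <=
    (k.+1 * #|A| ^ 3)%:R * quotient_num A k.+1 l i.
Proof.
move=> iA kA xi.
have le_del m : (m <= k)%N -> e A m <= #|A|%:R * e (A :\ i) m.
  move=> mk; have [xi0|xi0] := ltP (x i) 0; first exact: le_esub_del_neg.
  case: xi => [|xmin]; first by rewrite ltNge xi0.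
  apply: le_esub_del_min => // [j|]; first exact: le_trans (xmin j).
  exact: leq_ltn_trans kA.
apply: le_trans sum_quotient_num_le _.
have : e A k * e A l <= #|A|%:R * e (A :\ i) k * (#|A|%:R * e (A :\ i) l).
  by apply: ler_pM; rewrite ?le_del// ltW// pos// ltnW.
have := quotient_num_ge iA; rewrite natrM natrX.
move: (quotient_num _ _ _ _) (e A k * e A l) (e _ k) (e _ l) => q u v w.
have : 0 <= #|A|%:R :> R by [].
move: (#|A|%:R) (k.+1%:R) => N K N0 qvw uvw.
apply: le_trans (_ : N * (N * v * (N * w)) <= _); first exact: ler_wpM2l.
have -> : N * (N * v * (N * w)) = N ^+ 3 * (v * w) by ring.
have -> : K * N ^+ 3 * q = N ^+ 3 * (K * q) by ring.
by rewrite ler_wpM2l// exprn_ge0.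
Qed.

End Cone.

End ElementarySymmetric.

(** * Differentiation of the Hessian quotient *)

Lemma is_derive_coord (R : realType) (n : nat) (a v : 'rV[R]_n) (i : 'I_n) :
  is_derive a v (fun u : 'rV[R]_n => u 0 i : R^o) (v 0 i).
Proof.
have /derivable_mxP d : derivable (id : 'rV[R]_n -> 'rV[R]_n) a v by exact: derivable_id.
apply: DeriveDef; first exact: d.
have := derive_mx (@derivable_id _ _ a v); rewrite derive_id => /rowP/(_ i).
by rewrite mxE.
Qed.

(** The chain rule, with [desub] as partial derivatives; the induction splits off one entry and
    applies the product rule. *)
Lemma is_derive_esub (R : realType) (V : normedModType R) (T : finType)
    (f : T -> V -> R^o) (a v : V) (df : T -> R) (A : {set T}) (m : nat) :
  (forall i, is_derive a v (f i) (df i)) ->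
  is_derive a v (fun u => esub (f^~ u) A m : R^o)
    (\sum_(i in A) df i * desub (f^~ a) A i m).
Proof.
move=> fd.
have [n le_n] := ubnP #|A|; elim: n A m le_n => // n IH A m le_n.
case: m => [|m] /=.
  rewrite big1 => [|i _]; last by rewrite mulr0.
  have -> : (fun u => esub (f^~ u) A 0 : R^o) = cst 1.
    by apply/funext => u; rewrite esub0.
  exact: is_derive_cst.
have [->|[i0 iA]] := finset.set_0Vmem A.
  rewrite big_set0.
  have -> : (fun u => esub (f^~ u) finset.set0 m.+1 : R^o) = cst 0.
    by apply/funext => u; rewrite esub_set0.
  exact: is_derive_cst.
have cA : (#|A :\ i0| < n)%N by rewrite (cardsD1 i0) iA in le_n.
have -> : (fun u => esub (f^~ u) A m.+1 : R^o) =
  (fun u => esub (f^~ u) (A :\ i0) m.+1 : R^o) +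
  f i0 * (fun u => esub (f^~ u) (A :\ i0) m : R^o).
  by apply/funext => u; rewrite (esub_split _ _ iA).
apply: is_derive_eq (is_deriveD (IH _ m.+1 cA) (is_deriveM (fd i0) (IH _ m cA))) _.
rewrite (bigD1 i0 iA) addrA addrC; congr (_ + _); first by rewrite /GRing.scale/= mulrC.
rewrite scaler_sumr -big_split/=.
apply: eq_big => [i|i]; first by rewrite !inE andbC.
rewrite !inE => /andP[ii0 iA'].
have i0A : i0 \in A :\ i by rewrite !inE eq_sym ii0.
rewrite (esub_desub _ _ i0A).
rewrite /GRing.scale/=.
have -> : desub (f^~ a) (A :\ i) i0 m = desub (f^~ a) (A :\ i0) i m.
  by case: m => //= m; rewrite !finset.setDDl [[set i] :|: _]finset.setUC.
by rewrite !finset.setDDl [[set i] :|: _]finset.setUC; ring.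
Qed.

Lemma sigma_esub (R : realType) (N m : nat) (x : 'rV[R]_N) :
  sigma m x = esub (fun j => x 0 j) (finset.setT : {set 'I_N}) m.
Proof. by rewrite sigmaE; apply: eq_bigl => h; rewrite finset.subsetT. Qed.

(** The coefficient of lambda_i in the j-th entry of [Lambda], hence the partial derivative of that
    entry. *)
Definition occurrences (p n : nat) (i : 'I_n) (j : 'I_('C(n, p))) : nat :=
  \sum_(q < p) (tnth (multi_index j) q == i).

Lemma sum_occurrences (p n : nat) (j : 'I_('C(n, p))) :
  (\sum_(i < n) occurrences i j)%N = p.
Proof.
rewrite exchange_big /= -[RHS]card_ord -sum1_card; apply: eq_bigr => q _.
by rewrite (bigD1 (tnth (multi_index j) q))//= eqxx big1// => i /negPf; rewrite eq_sym => ->.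
Qed.

Lemma occurrences_gt0 (p n : nat) (i : 'I_n) (j : 'I_('C(n, p))) :
  i \in (multi_index j : seq _) -> (0 < occurrences i j)%N.
Proof. by case/tnthP => q ->; rewrite /occurrences (bigD1 q)//= eqxx. Qed.

Lemma is_derive_Lambda (R : realType) (p n : nat) (a : 'rV[R]_n) (i : 'I_n)
    (j : 'I_('C(n, p))) :
  is_derive a (delta_mx 0 i) (fun u => Lambda p u 0 j : R^o) (occurrences i j)%:R.
Proof.
have -> : (fun u => Lambda p u 0 j : R^o) =
    \sum_(q < p) (fun u : 'rV[R]_n => u 0 (tnth (multi_index j) q) : R^o).
  by apply/funext => u; rewrite fct_sumE mxE.
rewrite natr_sum.
apply: is_derive_eq (is_derive_sum (fun q => is_derive_coord a (delta_mx 0 i) _)) _.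
by apply: eq_bigr => q _; rewrite mxE eqxx.
Qed.

Lemma partial_hessian_quotient (R : realType) (p n k l : nat) (i : 'I_n)
    (a : 'rV[R]_n) : sigma l (Lambda p a) != 0 ->
  partial i (hessian_quotient p k l) a =
  (\sum_(j in finset.setT) (occurrences i j)%:R *
    quotient_num (fun j => Lambda p a 0 j) finset.setT k l j) / sigma l (Lambda p a) ^+ 2.
Proof.
move=> l0; rewrite /partial.
have d m := is_derive_esub finset.setT m (is_derive_Lambda (p := p) a i).
have E m : (fun u => sigma m (Lambda p u) : R^o) =
   (fun u => esub (fun j => Lambda p u 0 j) finset.setT m : R^o).
  by apply/funext => u; rewrite sigma_esub.
have dk := d k; have dl := d l; rewrite -!E in dk dl.
have -> : (hessian_quotient p k l : 'rV[R]_n -> R^o) =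
    (fun u => sigma k (Lambda p u) : R^o) * (fun u => (sigma l (Lambda p u))^-1 : R^o).
  by [].
have [dk1 dk2] := dk; have [dl1 dl2] := dl.
rewrite deriveM; [|exact: dk1|exact: derivableV].
rewrite deriveV//.
rewrite dk2 dl2 /GRing.scale/=.
rewrite [X in _ = X / _](_ : _ = sigma l (Lambda p a) *
    (\sum_(j in finset.setT) (occurrences i j)%:R *
        desub (Lambda p a 0) finset.setT j k) -
   sigma k (Lambda p a) * (\sum_(j in finset.setT) (occurrences i j)%:R *
        desub (Lambda p a 0) finset.setT j l)); last first.
  rewrite !mulr_sumr -sumrB; apply: eq_bigr => j _.
  by rewrite /quotient_num !sigma_esub; ring.
by field.
Qed.

(** * Multi-indices as p-subsets, and the choice of a suitable one *)

(** [enum] lists the elements of an ordinal subset in increasing order, as a multi-index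
    requires. *)
Lemma exists_multi_index_enum (p n : nat) (S : {set 'I_n}) : #|S| = p ->
  exists j : 'I_('C(n, p)), multi_index j = enum S :> seq _.
Proof.
move=> cS; have sE : size (enum S) == p by rewrite -cardE cS.
have tE : Tuple sE \in multi_indices p n.
  rewrite inE /= -[enum _](eq_filter (mem_enum _)).
  rewrite -(eq_filter (mem_map val_inj _)) -filter_map.
  by rewrite (sorted_filter ltn_trans) // unlock val_ord_enum iota_ltn_sorted.
exists (cast_ord (card_multi_indices p n) (enum_rank_in tE (Tuple sE))).
by rewrite /multi_index cast_ordK enum_rankK_in.
Qed.

Lemma multi_index_uniq (p n : nat) (j : 'I_('C(n, p))) : uniq (multi_index j).
Proof.
have : multi_index j \in multi_indices p n by exact: enum_valP.
rewrite inE => /(sorted_uniq ltn_trans ltnn).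
by rewrite map_inj_uniq//; exact: val_inj.
Qed.

Lemma LambdaE (R : realType) (p n : nat) (a : 'rV[R]_n) (j : 'I_('C(n, p))) :
  Lambda p a 0 j = \sum_(i in [set i in (multi_index j : seq _)]) a 0 i.
Proof.
rewrite mxE -(big_tuple _ _ _ xpredT (fun i => a 0 i)) big_uniq ?multi_index_uniq//.
by apply: eq_bigl => i; rewrite inE.
Qed.

(* Starting from a smallest Lambda_J, an entry of J is exchanged for i: either
   this does not increase the sum, or every entry of J is below lambda_i < 0 and
   so is the new sum. *)
Lemma exists_neg_or_min_multi_index (R : realType) (p n : nat) (a : 'rV[R]_n) (i : 'I_n) :
  (1 <= p)%N -> (0 < 'C(n, p))%N -> a 0 i < 0 ->
  exists2 j : 'I_('C(n, p)), i \in (multi_index j : seq _) &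
    Lambda p a 0 j < 0 \/ forall j', Lambda p a 0 j <= Lambda p a 0 j'.
Proof.
move=> p0 N0 ai.
have [J _ Jmin] := arg_minP (fun j : 'I_('C(n, p)) => Lambda p a 0 j) (erefl : xpredT (Ordinal N0)).
have {}Jmin j' : Lambda p a 0 J <= Lambda p a 0 j' by exact: Jmin.
have [iJ|iJ] := boolP (i \in (multi_index J : seq _)); first by exists J => //; right.
pose S : {set 'I_n} := [set i in (multi_index J : seq _)].
have cS : #|S| = p by rewrite cardsE (card_uniqP (multi_index_uniq J)) size_tuple.
have iS : i \notin S by rewrite inE.
have swap q : q \in S -> exists2 j : 'I_('C(n, p)), i \in (multi_index j : seq _) &
    Lambda p a 0 j = a 0 i + \sum_(r in S :\ q) a 0 r.
  move=> qS; have [] := @exists_multi_index_enum p n (i |: (S :\ q)).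
    by rewrite cardsU1 in_setD1 (negPf iS) andbF /= add1n -cS (cardsD1 q S) qS.
  move=> j jE; exists j; first by rewrite jE mem_enum setU11.
  rewrite LambdaE -big_setU1/=; last by rewrite in_setD1 (negPf iS) andbF.
  by apply: eq_bigl => r; rewrite inE jE mem_enum.
have LJ q : q \in S -> Lambda p a 0 J = a 0 q + \sum_(r in S :\ q) a 0 r.
  by move=> qS; rewrite LambdaE (big_setD1 q qS).
have [/existsP[q /andP[qS aiq]]|/existsPn H] := boolP [exists q, (q \in S) && (a 0 i <= a 0 q)].
  have [j ij jE] := swap q qS; exists j => //; right => j'.
  by apply: le_trans (Jmin j'); rewrite jE (LJ q qS) lerD2r.
have /card_gt0P[q qS] : (0 < #|S|)%N by rewrite cS.
have [j ij jE] := swap q qS; exists j => //; left.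
rewrite jE; apply: (ltr_wnDr _ ai); apply: sumr_le0 => r /setD1P[_ rS].
by have := H r; rewrite rS /= -ltNge => ari; exact: ltW (lt_trans ari ai).
Qed.

Theorem lemma2p9 (R : realType) (n p k l : nat)
    (hn : (2 <= n)%N) (hp : (1 <= p < n)%N)
    (hk : (2 <= k <= 'C(n, p))%N) (hl : (l < k)%N) :
  exists C1 : R, 0 < C1 /\
    forall lambda : 'rV[R]_n, Pcone p k lambda ->
      lambda 0 (Ordinal (ltnW hn)) < 0 ->
      C1 * \sum_(i < n) partial i (hessian_quotient p k l) lambda <=
        partial (Ordinal (ltnW hn)) (hessian_quotient p k l) lambda.
Proof.
have /andP[p0 pn] := hp; have /andP[k2 kN] := hk.
have N0 : (0 < 'C(n, p))%N by rewrite bin_gt0; exact: ltnW.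
(* From here on [k] is one less than in the statement, as in section [Cone]. *)
case: k k2 kN hl {hk} => // k k2 kN lk.
(* The factor p is the total weight of a multi-index over all i; the rest is the constant of
   [quotient_num_lower]. *)
pose D : R := p%:R * (k.+1 * 'C(n, p) ^ 3)%:R.
have D0 : 0 < D by rewrite mulr_gt0// ltr0n// muln_gt0/= expn_gt0 N0.
exists D^-1; split=> [|a cone ai]; first by rewrite invr_gt0.
pose x j := Lambda p a 0 j.
have pos m : (m <= k.+1)%N -> 0 < esub x finset.setT m.
  by case: m => [|m] mk; [rewrite esub0|rewrite -sigma_esub cone].
have sl : 0 < sigma l (Lambda p a) by rewrite sigma_esub pos// ltnW.
have sl0 := lt0r_neq0 sl.
under eq_bigr do rewrite partial_hessian_quotient//.
rewrite partial_hessian_quotient// -mulr_suml mulrA ler_pM2r ?invr_gt0 ?exprn_gt0//.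
(* Summing over i first gives every numerator the same weight p. *)
rewrite exchange_big /=.
under eq_bigr do rewrite -mulr_suml -natr_sum sum_occurrences.
rewrite -mulr_sumr ler_pdivrMl//.
have [j ij jmin] := exists_neg_or_min_multi_index p0 N0 ai.
have q0 j' : 0 <= quotient_num x finset.setT k.+1 l j'.
  by apply: quotient_num_ge0 => //; rewrite finset.in_setT.
have cT : #|[set: 'I_('C(n, p))]| = 'C(n, p) by rewrite cardsT card_ord.
have := @quotient_num_lower _ _ x finset.setT k l pos lk j (finset.in_setT j).
rewrite cT => /(_ kN jmin) low.
rewrite /D -mulrA ler_pM2l ?ltr0n//.
apply: le_trans low _; rewrite ler_pM2l ?ltr0n ?muln_gt0 ?expn_gt0 ?N0//.
(* Only the term of the chosen [j] is kept: its weight is at least 1 and the other terms are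
   nonnegative. *)
rewrite (bigD1 j) ?finset.in_setT//= ler_wpDr//.
  by apply: sumr_ge0 => j' _; rewrite mulr_ge0.
by rewrite ler_peMl// ler1n occurrences_gt0.
Qed.
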